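(* For every integer $t\ge 4$, there exists an integer $n_0=n_0(t)$ such that for all $n\ge n_0$ with $t\mid n$, $$t^3(n,t)\ge\left(1-193(t-1)^{-2}\log(t-1)\right)n.$$
   Context: A $3$-graph $H$ is a pair $(V(H),E(H))$ with $V(H)$ finite and $E(H)$ a set of $3$-element subsets of $V(H)$; its order is $|V(H)|$. $\delta_2(H)$ is the minimum, over all pairs $T$ of vertices, of the number of vertices $v$ such that $T\cup\{v\}$ is an edge. $K_t^3$ is the complete $3$-graph on $t$ vertices. A $K_t^3$-factor in $H$ is a spanning subgraph consisting of vertex-disjoint copies of $K_t^3$. For $t\mid n$, $t^3(n,t)$ is the smallest integer $d$ such that every $3$-graph $H$ of order $n$ with $\delta_2(H)\ge d$ contains a $K_t^3$-factor. $\log$ denotes the natural logarithm. *)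

(* Defs.v *)
From mathcomp Require Import all_boot.
From mathcomp Require Import boolp.

Set Implicit Arguments.
Unset Strict Implicit.
Unset Printing Implicit Defensive.

Record graph3 := Graph3 {
  vertices : finType;
  edges : {set {set vertices}};
  edges_card : forall e, e \in edges -> #|e| = 3
}.

Definition graph_order (H : graph3) : nat := #|vertices H|.

Definition codegree (H : graph3) (T : {set vertices H}) : nat :=
  #|[set v | v |: T \in edges H]|.

(* The default value [graph_order H] is an upper bound of every codegree, so it only
   matters when [H] has fewer than two vertices. *)
Definition delta2 (H : graph3) : nat :=
  \big[minn/graph_order H]_(T : {set vertices H} | #|T| == 2) codegree T.

Definition complete_edges (V : finType) (S : {set V}) : {set {set V}} :=
  [set e : {set V} | (e \subset S) && (#|e| == 3)].

(* The factor is given by the vertex sets of its copies of K_t^3. *)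
Definition has_factor (t : nat) (H : graph3) : Prop :=
  exists P : {set {set vertices H}},
    [/\ partition P [set: vertices H],
        forall S, S \in P -> #|S| = t
      & \bigcup_(S in P) complete_edges S \subset edges H].

Definition forces_factor (n t d : nat) : Prop :=
  forall H : graph3, graph_order H = n -> d <= delta2 H -> has_factor t H.

Lemma delta2_le_graph_order (H : graph3) : delta2 H <= graph_order H.
Proof.
rewrite /delta2; elim/big_rec: _ => [//|T m _ le_m].
exact: leq_trans (geq_minr _ _) le_m.
Qed.

Lemma forces_factor_ex (n t : nat) : exists d, `[< forces_factor n t d >].
Proof.
exists n.+1; apply/asboolP => H <- lt_order.
by have := leq_trans lt_order (delta2_le_graph_order H); rewrite ltnn.
Qed.

Definition t3 (n t : nat) : nat := ex_minn (forces_factor_ex n t).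

(* Main.v *)
Require Import Defs.
From mathcomp Require Import all_boot all_order all_algebra.
From mathcomp Require Import reals exp.
From mathcomp Require Import boolp sequences.
From mathcomp Require Import zify ring lra.
Import Order.TTheory GRing.Theory Num.Theory.

(** Put k = t - 1.  To bound t3 n t from below it suffices to find a 3-graph of
    order n with large minimum codegree in which one vertex v0 lies in no copy
    of K_t^3.

    Suppose S is a triple system on N points such that every k-set of points
    contains a triple of S and every pair of points lies in at most d triples.
    Split the n vertices into N nearly equal parts indexed by the points, and
    delete from the complete 3-graph every triple v0 x y with x and y in the same
    part, and every triple avoiding v0 whose vertices lie in three distinct parts
    indexed by a triple of S.  In a t-vertex clique through v0 the other k vertices must
    lie in distinct parts because of the first deletion; the k indices then
    contain a triple of S, so the second deletion destroys the clique
    ([blowup_no_factor]).  A pair of vertices loses about n / N third vertices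
    through the first deletion, or about d n / N through the second
    ([blowup_codegree]), so t3 n t is at least (1 - (d + O(1)) / N) n
    ([t3_ge_hitting_system]).

    It remains to make d / N as small as about 192 (log k) / k^2.  A random S
    does this: take N = k^3 and keep each triple with probability
    p = 48 (log k) / k^2.  A k-set contains no triple with probability
    (1 - p)^C(k, 3) <= exp (- 4 k log k), while there are at most
    k^(3 k) = exp (3 k log k) such sets.  The codegree of a pair is about
    p N = 48 k log k, and exceeding 192 k log k has probability exponentially
    small in k log k, against k^6 pairs ([exists_sparse_triple_system],
    [hitting_system_exists]).  The unit between 192 and 193 absorbs the additive
    constants.  The probability p makes sense since the claimed bound is at most 0
    when 193 log k >= k^2. *)

(** * Lower bounds on the factor threshold *)

Lemma delta2_ge (H : graph3) (m : nat) :
  m <= graph_order H ->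
  (forall T : {set vertices H}, #|T| = 2 -> m <= codegree T) -> m <= delta2 H.
Proof.
move=> mo mT; apply: (big_ind (fun x => m <= x)) => //.
  by move=> x y mx my; rewrite leq_min mx.
by move=> T /eqP; apply: mT.
Qed.

Lemma t3_gt_delta2 (t : nat) (H : graph3) :
  ~ has_factor t H -> delta2 H < t3 (graph_order H) t.
Proof.
move=> nof; rewrite /t3; case: ex_minnP => d /asboolP forces _.
by rewrite ltnNge; apply/negP => /(forces H erefl).
Qed.

(** * Blowing up a triple system around a special vertex *)

Lemma card_modn_fiber (n N : nat) (j : 'I_N) :
  #|[set x : 'I_n | x %% N == j]| <= n %/ N + 1.
Proof.
have N0 : 0 < N by case: N j => [[]|].
have q (x : 'I_n) : x %/ N < (n %/ N).+1 by rewrite ltnS leq_div2r// ltnW.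
rewrite -[X in _ <= X]card_ord addn1 -(@card_in_imset _ _ (fun x => Ordinal (q x))).
  exact: max_card.
move=> x y; rewrite !inE => /eqP xj /eqP yj [qe]; apply: val_inj => /=.
by rewrite (divn_eq x N) (divn_eq y N) qe xj yj.
Qed.

(** The triples to delete.  When e has three elements and contains v0, the image
    of the other two is a singleton exactly when they share a part.  When e avoids
    v0, its image can be a member of the triple system S only if its vertices lie
    in three distinct parts. *)
Definition blocked {V I : finType} (v0 : V) (part : V -> I) (S : {set {set I}})
    (e : {set V}) : bool :=
  if v0 \in e then #|part @: (e :\ v0)| == 1 else part @: e \in S.

Definition blowup_edges {V I : finType} (v0 : V) (part : V -> I) (S : {set {set I}}) :
    {set {set V}} :=
  [set e : {set V} | (#|e| == 3) && ~~ blocked v0 part S e].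

Lemma blowup_edges_card {V I : finType} (v0 : V) (part : V -> I) (S : {set {set I}})
    (e : {set V}) : e \in blowup_edges v0 part S -> #|e| = 3.
Proof. by rewrite inE => /andP[/eqP]. Qed.

Definition blowup {V I : finType} (v0 : V) (part : V -> I) (S : {set {set I}}) : graph3 :=
  Graph3 (@blowup_edges_card V I v0 part S).

(** The copy covering v0 is the obstruction: its other vertices have distinct
    parts, hence their t - 1 parts contain a triple of S, which lifts to a
    deleted triple inside the copy. *)
Lemma blowup_no_factor (V I : finType) (v0 : V) (part : V -> I) (S : {set {set I}})
    (t : nat) :
  (forall e, e \in S -> #|e| = 3) ->
  (forall K : {set I}, #|K| = t.-1 -> exists2 e, e \in S & e \subset K) ->
  ~ has_factor t (blowup v0 part S).
Proof.
move=> S3 Shit [P [partP cardP subE]].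
pose A := pblock P v0.
have v0c : v0 \in cover P by rewrite (cover_partition partP) inE.
have AP : A \in P by exact: pblock_mem.
have v0A : v0 \in A by rewrite mem_pblock.
have free (e : {set V}) : e \subset A -> #|e| = 3 -> ~~ blocked v0 part S e.
  move=> eA e3; suff : e \in blowup_edges v0 part S by rewrite inE => /andP[].
  apply: (subsetP subE); apply/bigcupP; exists A => //.
  by rewrite inE eA e3.
pose W := A :\ v0.
have part_inj : {in W &, injective part}.
  move=> x y; rewrite !inE => /andP[xv xA] /andP[yv yA] pxy.
  apply/eqP; apply/negPn/negP => xy.
  have v0n : v0 \notin [set x; y] by rewrite !inE negb_or !(eq_sym v0) xv.
  have := free (v0 |: [set x; y]).
  rewrite cardsU1 v0n cards2 xy !subUset !sub1set v0A xA yA => /(_ isT erefl).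
  rewrite /blocked setU11 setU1K// imsetU1 imset_set1 pxy setUid cards1.
  by [].
have [e eS eW] : exists2 e, e \in S & e \subset part @: W.
  apply: Shit; rewrite card_in_imset// -(cardP _ AP).
  by rewrite (cardsD1 v0 A) v0A.
pose e' := W :&: part @^-1: e.
have im_e' : part @: e' = e.
  apply/eqP; rewrite eqEsubset; apply/andP; split; apply/subsetP => i.
    by case/imsetP => x; rewrite !inE => /andP[_ xe] ->.
  move=> ie; have /imsetP[x xW xi] := subsetP eW i ie.
  by rewrite xi; apply: imset_f; rewrite in_setI xW inE -xi.
have := free e'; rewrite /blocked !inE eqxx /= im_e' eS.
suff [e'A e'3] : e' \subset A /\ #|e'| = 3 by move/(_ e'A e'3).
split; first by apply: subset_trans (subsetIl _ _) (subsetDl _ _).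
rewrite -(S3 _ eS) -im_e' card_in_imset// => x y /setIP[xW _] /setIP[yW _].
exact: part_inj.
Qed.

(** If T contains v0 then the third vertices lost all lie in the part of the
    other vertex of T.  Otherwise they are v0, possibly, and vertices in the at most d
    parts that complete the two parts of T to a triple of S; if T lies in a single
    part no third part gives a triple.  The 3 accounts for T itself and v0. *)
Lemma blowup_codegree (V I : finType) (v0 : V) (part : V -> I) (S : {set {set I}})
    (d q : nat) (T : {set V}) :
  (forall e, e \in S -> #|e| = 3) ->
  (forall T : {set I}, #|T| = 2 -> #|[set i | i |: T \in S]| <= d) ->
  (forall i, #|[set x | part x == i]| <= q) ->
  #|T| = 2 -> #|V| <= codegree (H := blowup v0 part S) T + d.+1 * q + 3.
Proof.
move=> S3 Sd fib T2.
pose B := [set w | (w \notin T) && blocked v0 part S (w |: T)].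
have cover : [set: V] \subset [set v | v |: T \in blowup_edges v0 part S] :|: T :|: B.
  apply/subsetP => w _; rewrite !inE cardsU1 T2.
  by case: (w \in T); rewrite ?orbT//=; case: (blocked _ _ _ _).
have cardV : #|V| <= codegree (H := blowup v0 part S) T + 2 + #|B|.
  rewrite -cardsT; apply: leq_trans (subset_leq_card cover) _.
  apply: leq_trans (leq_card_setU _ _) _; rewrite leq_add2r -T2.
  exact: leq_card_setU.
suff : #|B| <= d.+1 * q + 1 by move: cardV; lia.
have [v0T|v0T] := boolP (v0 \in T).
  have /cards1P[y Ty] : #|T :\ v0| == 1 by move: (cardsD1 v0 T); rewrite v0T T2; lia.
  suff BF : B \subset [set x | part x == part y].
    by have := fib (part y); have := subset_leq_card BF; rewrite mulSn; lia.
  apply/subsetP => w; rewrite !inE /blocked setU1r// => /andP[wT].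
  have wv : w != v0 by apply: contraNneq wT => ->.
  have -> : (w |: T) :\ v0 = [set w; y].
    by rewrite setDUl Ty; congr (_ :|: _); apply/setDidPl; rewrite disjoints1 inE.
  by rewrite imsetU1 imset_set1 cards2; case: (part w == part y).
pose D := [set i | i |: part @: T \in S].
have Dd : #|D| <= d.
  have [/eqP/Sd//|Tn2] := boolP (#|part @: T| == 2).
  rewrite (_ : D = set0) ?cards0//; apply/setP => i; rewrite !inE.
  apply/negP => /S3; rewrite cardsU1; have := leq_imset_card part T; rewrite T2.
  by move: Tn2; case: (i \notin _) => /eqP /=; lia.
have BD : B \subset v0 |: \bigcup_(i in D) [set x | part x == i].
  apply/subsetP => w; rewrite !inE /blocked => /andP[wT].
  rewrite !inE (negPf v0T) orbF eq_sym; case: eqP => //= _.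
  rewrite imsetU1 => wS; apply/bigcupP; exists (part w); by rewrite inE.
apply: leq_trans (subset_leq_card BD) _.
apply: leq_trans (leq_card_setU _ _) _; rewrite cards1 addnC leq_add2r.
apply: leq_trans (_ : #|D| * q <= _); last by rewrite leq_mul2r ltnW ?orbT.
apply: leq_trans (_ : \sum_(i in D) #|[set x | part x == i]| <= _).
  elim/big_rec2: _ => [|i m A _ le_m]; first by rewrite cards0.
  by apply: leq_trans (leq_card_setU _ _) _; rewrite leq_add2l.
by rewrite -sum_nat_const; apply: leq_sum => i _; apply: fib.
Qed.

(** The parts are the residue classes modulo N, and v0 is the vertex 0. *)
Lemma t3_ge_hitting_system (t n N d : nat) (S : {set {set 'I_N}}) :
  0 < N -> 0 < n ->
  (forall e, e \in S -> #|e| = 3) ->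
  (forall T : {set 'I_N}, #|T| = 2 -> #|[set v | v |: T \in S]| <= d) ->
  (forall K : {set 'I_N}, #|K| = t.-1 -> exists2 e, e \in S & e \subset K) ->
  n <= t3 n t + d.+1 * (n %/ N + 1) + 2.
Proof.
move=> N0 n0 S3 Sd Shit.
pose part (x : 'I_n) : 'I_N := Ordinal (ltn_pmod x N0).
pose H := blowup (Ordinal n0) part S.
have nof : ~ has_factor t H by exact: blowup_no_factor.
have := t3_gt_delta2 t H nof; rewrite [graph_order H]card_ord.
suff : n - (d.+1 * (n %/ N + 1) + 3) <= delta2 H by lia.
apply: delta2_ge => [|T T2]; first by rewrite [graph_order H]card_ord leq_subr.
have fib i : #|[set x | part x == i]| <= n %/ N + 1.
  by apply: leq_trans (card_modn_fiber n N i); apply/eq_leq/eq_card => x; rewrite !inE.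
have := blowup_codegree _ _ (Ordinal n0) part S d _ T S3 Sd fib T2.
rewrite card_ord -/H; lia.
Qed.

(** * Random subsets with independent elements *)

Local Open Scope ring_scope.

(** The probability of the outcome J when each element of E is kept
    independently with probability p. *)
Definition biased_weight {R : realType} {E : finType} (p : R) (J : {set E}) : R :=
  \prod_(e : E) (if e \in J then p else 1 - p).

Lemma biased_weight_ge0 (R : realType) (E : finType) (p : R) (J : {set E}) :
  0 <= p <= 1 -> 0 <= biased_weight p J.
Proof.
by case/andP=> p0 p1; apply: prodr_ge0 => e _; case: ifP; rewrite ?subr_ge0.
Qed.

(** The probability generating function of the binomial variable #|J :&: A|.
    At x = 0 it is the probability that J misses A, as 0 ^+ 0 = 1; at x = 2 it
    bounds large deviations of #|J :&: A|. *)
Lemma sum_biased_weight_expr (R : realType) (E : finType) (p x : R) (A : {set E}) :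
  \sum_(J : {set E}) biased_weight p J * x ^+ #|J :&: A| =
  (1 - p + p * x) ^+ #|A|.
Proof.
rewrite -prodr_const [RHS]big_mkcond /=.
transitivity (\prod_(e : E) ((if e \in A then p * x else p) + (1 - p))).
  rewrite bigA_distr; apply: eq_big => [J|J _]; first by rewrite inE.
  rewrite -prodr_const (big_mkcond (fun e => e \in J :&: A)) -big_split /=.
  by apply: eq_bigr => e _; rewrite inE; case: (e \in J); case: (e \in A);
     rewrite ?mulr1.
by apply: eq_bigr => e _; case: (e \in A); ring.
Qed.

Lemma sum_biased_weight (R : realType) (E : finType) (p : R) :
  \sum_(J : {set E}) biased_weight p J = 1.
Proof.
have := @sum_biased_weight_expr R E p 1 set0.
rewrite cards0 expr0 => <-.
by apply: eq_bigr => J _; rewrite expr1n mulr1.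
Qed.

Lemma exists_lt1_of_mean (R : realType) (E : finType) (p : R)
    (phi : {set E} -> R) :
  0 <= p <= 1 -> \sum_(J : {set E}) biased_weight p J * phi J < 1 ->
  exists J, phi J < 1.
Proof.
move=> p01 lt1; apply/not_existsP => all_ge1; move: lt1; apply/negP.
rewrite -leNgt -(@sum_biased_weight R E p); apply: ler_sum => J _.
rewrite ler_peMr ?biased_weight_ge0// leNgt; exact/negP/all_ge1.
Qed.

(** * A sparse triple system meeting every k-set *)

(** First moment method.  The potential of a random set J of vertex sets counts
    the k-sets containing no triple of J, and adds 2 ^ (codegree - (d + 1)) for
    every pair.  The hypothesis puts its mean below 1, so some J has
    potential below 1; then every term is below 1, which excludes both an
    unhit k-set and a pair of codegree above d. *)
Lemma exists_sparse_triple_system (R : realType) (V : finType) (k d : nat) (p : R) :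
  0 <= p <= 1 ->
  'C(#|V|, k)%:R * (1 - p) ^+ 'C(k, 3) +
    'C(#|V|, 2)%:R * ((1 + p) ^+ #|V| / 2 ^+ d.+1) < 1 ->
  exists S : {set {set V}},
    [/\ forall e, e \in S -> #|e| = 3%N,
        forall T : {set V}, #|T| = 2%N -> (#|[set v | v |: T \in S]| <= d)%N
      & forall K : {set V}, #|K| = k -> exists2 e, e \in S & e \subset K].
Proof.
move=> p01 lt1.
(* J may contain sets that are not triples, to be discarded at the end; such
   sets lie neither in star T for a pair T nor in complete_edges K. *)
pose star (T : {set V}) := [set v |: T | v in ~: T].
pose phi (J : {set {set V}}) : R :=
  \sum_(K : {set V} | #|K| == k) 0 ^+ #|J :&: complete_edges K| +
  \sum_(T : {set V} | #|T| == 2) 2 ^+ #|J :&: star T| / 2 ^+ d.+1.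
have phiE1 (J : {set {set V}}) (K : {set V}) :
    0 <= (0 : R) ^+ #|J :&: complete_edges K| by rewrite exprn_ge0.
have phiE2 (J : {set {set V}}) (T : {set V}) :
  0 <= (2 : R) ^+ #|J :&: star T| / 2 ^+ d.+1 by rewrite divr_ge0 ?exprn_ge0.
(* Linearity of the mean, with the generating function taken at 0 and 2. *)
have [J ltJ] : exists J, phi J < 1.
  apply: (@exists_lt1_of_mean _ _ p) => //; apply: le_lt_trans lt1.
  under eq_bigr => J _ do rewrite mulrDr !mulr_sumr.
  rewrite big_split /=; apply: lerD.
    rewrite exchange_big /= mulr_natl -card_draws -sumr_const big_mkcond [leRHS]big_mkcond /=.
    apply: ler_sum => K _; rewrite inE; case: eqP => // cK.
    by rewrite sum_biased_weight_expr mulr0 addr0 cards_draws cK.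
  rewrite exchange_big /= mulr_natl -card_draws -sumr_const big_mkcond [leRHS]big_mkcond /=.
  apply: ler_sum => T _; rewrite inE; case: eqP => // cT.
  under eq_bigr => J _ do rewrite mulrA.
  rewrite -mulr_suml sum_biased_weight_expr ler_pM2r ?invr_gt0 ?exprn_gt0//.
  have -> : 1 - p + p * 2 = 1 + p by ring.
  rewrite ler_weXn2l //; first by case/andP: p01 => p0 _; lra.
  by apply: leq_trans (leq_imset_card _ _) _; rewrite max_card.
exists [set e in J | #|e| == 3]; split => [e|T cT|K cK].
- by rewrite inE => /andP[_ /eqP].
- have lt2 : (2 : R) ^+ #|J :&: star T| < 2 ^+ d.+1.
    rewrite -[ltRHS]mul1r -ltr_pdivrMr ?exprn_gt0//; apply: le_lt_trans ltJ.
    rewrite /phi [X in _ + X](bigD1 T) /=; last by rewrite cT eqxx.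
    by rewrite addrCA lerDl addr_ge0// sumr_ge0.
  rewrite ltr_eXn2l ?ltr1n// ltnS in lt2; apply: leq_trans lt2.
  have notT v : v \in [set v | v |: T \in [set e in J | #|e| == 3]] -> v \notin T.
    by rewrite !inE => /andP[_]; rewrite cardsU1 cT; case: (v \in T).
  rewrite -(@card_in_imset _ _ (fun v => v |: T)).
    apply: subset_leq_card; apply/subsetP => _ /imsetP[v vJ ->].
    rewrite inE; apply/andP; split; last by apply: imset_f; rewrite inE notT.
    by move: vJ; rewrite !inE => /andP[].
  move=> v w /notT vT /notT wT eqvw.
  have : v \in w |: T by rewrite -eqvw setU11.
  by rewrite !inE (negPf vT) orbF => /eqP.
- suff : J :&: complete_edges K != set0.
    case/set0Pn=> e; rewrite !inE => /andP[eJ /andP[eK e3]].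
    by exists e; rewrite ?inE ?eJ.
  apply: contraTneq ltJ => J0; rewrite -leNgt /phi (bigD1 K) /=; last by rewrite cK.
  by rewrite J0 cards0 expr0 -addrA lerDl addr_ge0// sumr_ge0.
Qed.

Lemma bin_leq_expn (n m : nat) : ('C(n, m) <= n ^ m)%N.
Proof.
elim: n m => [|n IH] [|m] //=.
rewrite binS; have h1 := IH m.+1; have h2 := IH m.
apply: leq_trans (leq_add h1 h2) _.
have : (n ^ m <= n.+1 ^ m)%N by case: m {h1 h2} => // m; rewrite leq_exp2r.
rewrite !expnS; nia.
Qed.

Lemma bin3_ge (k : nat) : (6 <= k)%N -> (k ^ 3 <= 12 * 'C(k, 3))%N.
Proof.
move=> k6; have := bin_ffact k 3; have -> : 3`! = 6 by [].
rewrite !ffactnS ffactn0 /=; case: k k6 => [|[|[|k]]] //= k6; nia.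
Qed.

(** The parameters are N = k ^ 3, p = 48 L / k ^ 2 and d = floor (192 L k) with
    L = log k.  Since d + 1 > 4 p N and 2 >= exp (1 / 2), the codegree term is at
    most N ^ 2 exp (p N - 2 p N). *)
Lemma hitting_system_exists (R : realType) (k : nat) :
  (3 <= k)%N -> 193 * ln k%:R < k%:R ^+ 2 :> R ->
  exists N d : nat, exists S : {set {set 'I_N}},
    [/\ (0 < N)%N, forall e, e \in S -> #|e| = 3%N,
        forall T : {set 'I_N}, #|T| = 2%N -> (#|[set v | v |: T \in S]| <= d)%N,
        forall K : {set 'I_N}, #|K| = k -> exists2 e, e \in S & e \subset K
      & d.+2%:R <= 193 * (k%:R ^+ 2)^-1 * ln k%:R * N%:R :> R].
Proof.
move=> k3 small; set L : R := ln k%:R in small *.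
have k0 : 0 < k%:R :> R by rewrite ltr0n; lia.
(* Taken at 2 and at k, this gives log 2 >= 1 / 2 and log k >= 1 / 2. *)
have lnge (x : R) : 0 < x -> 1 - x^-1 <= ln x.
  move=> x0; have := @le_ln1Dx R (x^-1 - 1).
  have -> : 1 + (x^-1 - 1) = x^-1 by ring.
  by rewrite lnV ?posrE// ltrBrDl subrr invr_gt0 => /(_ x0); lra.
have L12 : 1/2 <= L.
  apply: le_trans (lnge _ k0).
  have : k%:R^-1 <= 2^-1 :> R by rewrite lef_pV2 ?posrE// ler_nat; lia.
  lra.
(* Since 193 L > 96 > 9 ^ 2. *)
have k9 : (9 < k)%N.
  rewrite ltnNge; apply/negP => k9.
  have : k%:R ^+ 2 <= 9 ^+ 2 :> R by rewrite ler_sqr ?nnegrE// ler_nat.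
  lra.
have kR : 10 <= k%:R :> R by rewrite ler_nat.
have expL : expR L = k%:R by rewrite lnK.
pose p : R := 48 * L / k%:R ^+ 2.
have p01 : 0 <= p <= 1.
  apply/andP; split; first by rewrite divr_ge0 ?exprn_ge0// mulr_ge0//; lra.
  rewrite ler_pdivrMr ?exprn_gt0//; lra.
have p0 : 0 <= p by case/andP: p01.
have expN (y : R) : 1 <= y -> expR (- y) <= 1/2.
  move=> y1; rewrite expRN -[leRHS]/(1/2) div1r lef_pV2 ?posrE ?expR_gt0//.
  by apply: le_trans (expR_ge1Dx y); lra.
pose d := Num.truncn (192 * L * k%:R).
have dle : d%:R <= 192 * L * k%:R by rewrite truncn_le mulr_ge0//; lra.
have dgt : 192 * L * k%:R < d.+1%:R by exact: truncnS_gt.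
have binb m : 'C(k ^ 3, m)%:R <= expR (3 * L * m%:R).
  apply: le_trans (_ : ((k ^ 3) ^ m)%:R <= _); first by rewrite ler_nat bin_leq_expn.
  by rewrite !natrX expRM_natr expRM_natl expL.
have Lk : 5 <= L * k%:R by nra.
have [] := @exists_sparse_triple_system R 'I_(k ^ 3) k d p p01.
  rewrite card_ord.
  apply: (@le_lt_trans _ _ (expR (- (L * k%:R)) + expR (6 * L - 48 * (L * k%:R)))).
    apply: lerD.
      apply: le_trans (_ : expR (3 * L * k%:R) * expR (- p * 'C(k, 3)%:R) <= _).
        rewrite ler_pM ?exprn_ge0//; first by case/andP: p01; lra.
        rewrite expRM_natr lerXn2r ?nnegrE ?expR_ge0//; first by case/andP: p01; lra.
        exact: expR_ge1Dx.
      rewrite -expRD ler_expR.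
      have c3 : k%:R ^+ 3 <= 12 * 'C(k, 3)%:R :> R.
        by rewrite -natrX -natrM ler_nat bin3_ge//; lia.
      have : p * k%:R ^+ 3 <= p * (12 * 'C(k, 3)%:R) by rewrite ler_wpM2l.
      have -> : p * k%:R ^+ 3 = 48 * (L * k%:R) by rewrite /p; field; lra.
      lra.
    apply: le_trans (_ : expR (3 * L * 2) *
        (expR (p * (k ^ 3)%:R) * expR (- (d.+1%:R / 2))) <= _).
      rewrite ler_pM// ?divr_ge0 ?exprn_ge0//; first lra.
      rewrite ler_pM ?invr_ge0 ?exprn_ge0//; first lra.
        rewrite expRM_natr lerXn2r ?nnegrE ?expR_ge0 ?expR_ge1Dx//; lra.
      rewrite expRN lef_pV2 ?posrE ?expR_gt0 ?exprn_gt0//.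
      rewrite mulrC expRM_natr lerXn2r ?nnegrE ?expR_ge0//.
      rewrite -[leRHS]lnK ?posrE// ler_expR.
      by have := lnge 2 (ltr0n _ 2); lra.
    rewrite -!expRD ler_expR.
    have -> : p * (k ^ 3)%:R = 48 * (L * k%:R) by rewrite natrX /p; field; lra.
    lra.
  have h1 := expN (L * k%:R); have h2 := expN (48 * (L * k%:R) - 6 * L).
  have : expR (- (L * k%:R)) < expR (-1) by rewrite ltr_expR; lra.
  have := expN 1; rewrite opprB in h2; nra.
move=> S [S3 Sd Sk].
exists (k ^ 3)%N, d, S; split => //; first by rewrite expn_gt0; lia.
have -> : 193 * (k%:R ^+ 2)^-1 * L * (k ^ 3)%:R = 193 * (L * k%:R).
  by rewrite natrX; field; lra.
rewrite -addn2 natrD; lra.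
Qed.

Theorem proposition1p6 (R : realType) (t : nat) (ht : (4 <= t)%N) :
  exists n0 : nat, forall n : nat, (n0 <= n)%N -> (t %| n)%N ->
    (1 - 193 * (t%:R - 1) ^- 2 * ln (t%:R - 1)) * n%:R <= (t3 n t)%:R :> R.
Proof.
have -> : t%:R - 1 = t.-1%:R :> R by rewrite -subn1 natrB//; lia.
have k3 : (3 <= t.-1)%N by lia.
have k0 : 0 < t.-1%:R ^+ 2 :> R by rewrite exprn_gt0// ltr0n; lia.
have [small|large] := ltP (193 * ln t.-1%:R) (t.-1%:R ^+ 2 : R); last first.
  exists 0%N => n _ _; apply: le_trans (ler0n _ _).
  rewrite mulr_le0_ge0// subr_le0 mulrAC ler_pdivlMr// mul1r.
  exact: large.
have [N [d [S [N0 S3 Sd Sk dN]]]] := @hitting_system_exists R t.-1 k3 small.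
exists (N * (d + 3))%N => n nn0 _.
have n0 : (0 < n)%N by apply: leq_trans nn0; rewrite muln_gt0 N0 addn3.
have t3n := t3_ge_hitting_system t n N d S N0 n0 S3 Sd Sk.
(* The total defect is at most (d + 2) n / N because n >= N (d + 3). *)
set loss := (d.+1 * (n %/ N + 1) + 2)%N.
have lossN : (N * loss <= d.+2 * n)%N.
  have nN : (N * (n %/ N) <= n)%N by rewrite mulnC leq_divM.
  have : (d.+1 * (N * (n %/ N)) <= d.+1 * n)%N by rewrite leq_mul2l nN.
  rewrite /loss; nia.
set c : R := 193 * t.-1%:R ^- 2 * ln t.-1%:R in dN *.
have : loss%:R <= c * n%:R.
  have NR : 0 < N%:R :> R by rewrite ltr0n.
  rewrite -(ler_pM2l NR) -natrM; apply: le_trans (_ : (d.+2 * n)%:R <= _).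
    by rewrite ler_nat.
  rewrite natrM; apply: le_trans (_ : c * N%:R * n%:R <= _); last by lra.
  by rewrite ler_wpM2r.
have : n%:R <= (t3 n t)%:R + loss%:R :> R by rewrite -natrD ler_nat /loss addnA.
lra.
Qed.
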